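(* Let $Q,T_1,T_2,X\in\mathcal{B}(\mathcal{H})$ be such that $T_1$, $T_2$ and $QT_2$ are contractions and $XT_1=QT_2X$. Let $V_1\in\mathcal{B}(\mathcal{K}_1)$ and $V_2\in\mathcal{B}(\mathcal{K}_2)$ be any isometric lifts of $T_1$ and $T_2$ respectively, where $\mathcal{K}_1,\mathcal{K}_2\supseteq\mathcal{H}$. Let $\overline{Q}\in\mathcal{B}(\mathcal{K}_2)$ be any lift of $Q$ such that $\overline{Q}V_2$ is a contraction. Then there is a norm preserving lift $Y:\mathcal{K}_1\to\mathcal{K}_2$ of $X$ such that $YV_1=\overline{Q}V_2Y$.
   Context: All Hilbert spaces are complex; $\mathcal{B}(\mathcal{H})$ is the algebra of bounded linear operators on $\mathcal{H}$; containment of Hilbert spaces means containment as a closed linear subspace; a contraction is an operator of norm at most one. For Hilbert spaces $\mathcal{H}_1\subseteq\mathcal{K}_1$ and $\mathcal{H}_2\subseteq\mathcal{K}_2$, an operator $Y\in\mathcal{B}(\mathcal{K}_1,\mathcal{K}_2)$ is a lift of $X\in\mathcal{B}(\mathcal{H}_1,\mathcal{H}_2)$ if $Y^*h=X^*h$ for all $h\in\mathcal{H}_2$ (so $Y^*$ maps $\mathcal{H}_2$ into $\mathcal{H}_1$); here $\mathcal{H}_1=\mathcal{H}_2=\mathcal{H}$. In particular $B\in\mathcal{B}(\mathcal{K})$ is a lift of $A\in\mathcal{B}(\mathcal{H})$ if $\mathcal{H}$ is invariant under $B^*$ and $B^*|_{\mathcal{H}}=A^*$. An isometric lift is a lift that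 is an isometry; a norm preserving lift $Y$ of $X$ is a lift with $\|Y\|=\|X\|$. *)

(* Defs.v *)
From HB Require Import structures.
From mathcomp Require Import all_boot all_order all_algebra.
From mathcomp Require Import sesquilinear.
From mathcomp Require Import complex.
From mathcomp Require Import all_classical all_reals.
From mathcomp Require Import topology normedtype.

Set Implicit Arguments.
Unset Strict Implicit.
Unset Printing Implicit Defensive.

Import Order.TTheory GRing.Theory Num.Theory.
Import numFieldNormedType.Exports.

Local Open Scope classical_set_scope.
Local Open Scope ring_scope.
Local Open Scope complex_scope.

(* [hdot] is linear in its first argument and conjugate-linear in its second.
   Norms of vectors are elements of [R[i]] (nonnegative reals). *)
HB.mixin Record CompleteNormedModule_isHilbert (R : realType) V
    & CompleteNormedModule R[i] V := {
  hdot : {dot V for (@Num.conj R[i])} ;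
  hdotxx : forall x : V, hdot x x = `|x| ^+ 2
}.

#[short(type="hilbertType")]
HB.structure Definition Hilbert (R : realType) :=
  {V of CompleteNormedModule R[i] V & CompleteNormedModule_isHilbert R V}.

HB.mixin Record isBoundedOperator (K : numFieldType) (V W : normedModType K)
    (f : V -> W) := {
  bounded_operator : exists M : K, forall x, `|f x| <= M * `|x|
}.

HB.structure Definition BoundedOperator (K : numFieldType)
    (V W : normedModType K) :=
  {f of @GRing.Linear K V W *:%R f & isBoundedOperator K V W f}.

Notation "{ 'bounded' V -> W }" := (@BoundedOperator.type _ V%type W%type)
  (at level 0, V at level 98, W at level 99,
   format "{ 'bounded'  V  ->  W }") : type_scope.

Section comp_bounded.
Variables (K : numFieldType) (U V W : normedModType K).
Variables (g : {bounded V -> W}) (f : {bounded U -> V}).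

Lemma bounded_operator_comp : exists M : K, forall x, `|(g \o f) x| <= M * `|x|.
Proof.
have [M gM] := @bounded_operator _ _ _ g; have [N fN] := @bounded_operator _ _ _ f.
exists (`|M| * N) => x /=; have h := gM (f x).
have [->|fx0] := eqVneq (f x) 0.
  rewrite linear0 normr0 -mulrA mulr_ge0//.
  exact: le_trans (fN x).
apply: (le_trans h); rewrite -mulrA.
have fxp : 0 < `|f x| by rewrite normr_gt0.
have M0 : 0 <= M by rewrite -(pmulr_lge0 _ fxp) (le_trans _ h).
by rewrite ger0_norm// ler_wpM2l.
Qed.

HB.instance Definition _ :=
  isBoundedOperator.Build K U W (g \o f) bounded_operator_comp.

End comp_bounded.

Section operators.
Variable R : realType.
Implicit Types V W : hilbertType R.

Definition opnorm V W (f : {bounded V -> W}) : R :=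
  sup [set complex.Re `|f x| | x in [set x | `|x| <= 1]].

Definition contraction_op V W (f : {bounded V -> W}) : Prop := opnorm f <= 1.

Definition isometric_op V W (f : {bounded V -> W}) : Prop :=
  forall x, `|f x| = `|x|.

(* [adjoint f y] is the unique [z] representing the bounded linear functional
   [x |-> hdot (f x) y]; it exists by the Riesz representation theorem, so the
   default value [0] is never used. *)
Definition adjoint V W (f : {bounded V -> W}) (y : W) : V :=
  xget 0 [set z | forall x, hdot (f x) y = hdot x z].

(* [H] as a closed subspace of [K] is an inner product preserving linear
   embedding [j : H -> K]; its range is closed since [H] is complete. *)
Definition hilbert_inclusion (H K : hilbertType R) (j : {linear H -> K}) : Prop :=
  isometry (@hdot R K) (@hdot R H) j.

(* [Y] is a lift of [X], where [H1] is seen in [K1] through [j1] and [H2] in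
   [K2] through [j2]. *)
Definition lift_of (H1 H2 K1 K2 : hilbertType R)
    (j1 : {linear H1 -> K1}) (j2 : {linear H2 -> K2})
    (X : {bounded H1 -> H2}) (Y : {bounded K1 -> K2}) : Prop :=
  forall h : H2, adjoint Y (j2 h) = j1 (adjoint X h).

End operators.

(* Main.v *)
Require Import Defs.
From HB Require Import structures.
From mathcomp Require Import all_boot all_order all_algebra.
From mathcomp Require Import sesquilinear.
From mathcomp Require Import complex.
From mathcomp Require Import all_classical all_reals.
From mathcomp Require Import topology normedtype.
From mathcomp Require Import ring lra.

Import Order.TTheory GRing.Theory Num.Theory.
Import numFieldNormedType.Exports.

Set Implicit Arguments.
Unset Strict Implicit.
Unset Printing Implicit Defensive.

Local Open Scope ring_scope.

(** The operators [S = Q T2] and [W = Qbar V2] satisfy [j2^* W = S j2^*], so [W]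
    is a contractive lift of the contraction [S].  With [X0 = X j1^* : K1 -> H]
    the hypotheses give [X0 V1 = S X0], and a lift [Y] of [X] is an operator with
    [j2^* Y = X0].  The claim is thus a commutant lifting theorem in which the
    lift [V1] on the source is isometric and the lift [W] on the target is only
    contractive.

    Since [W] need not be isometric, [Y] is first built on the Schaeffer
    dilation space of [S], that is [H] followed by a sequence of copies of [H],
    on which the isometric dilation sends [(h, h0, h1, ...)] to
    [(S h, D h, h0, h1, ...)], where [D = (1 - S^* S)^(1/2)]
    ([defect_operator]).  A map [x |-> (X0 x, c1 x, c2 x, ...)] intertwines [V1]
    with this dilation as soon as [c1 V1 = D X0] and [c(k+1) V1 = ck], and it has
    norm at most [r = |X|] as soon as the form
    [q_n(x) = r^2 |x|^2 - |X0 x|^2 - |c1 x|^2 - ... - |cn x|^2] stays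
    nonnegative.  With [c0 = D X0], the identity
    [q_n(V1 u) = q_n(u) + |cn u|^2] holds for [n = 0] because [V1] is isometric,
    and it reproduces itself ([defect_step]); it says that [cn] is a contraction
    for [q_n] on the range of [V1], so [c(n+1)] exists by projecting for [q_n]
    onto that range ([contractive_extension]), and [q_(n+1) >= 0] follows.

    It remains to map the dilation space to [K2].  The operator
    [W j2 - j2 S] maps [H] into the orthogonal complement of [H], which [W]
    leaves invariant, and contractivity of [W] makes it factor as [G D] with the
    row [(G, W)] contractive on that complement ([gamma_ex]).  Hence
    [Y = j2 X0 + G c1 + W G c2 + W^2 G c3 + ...] converges, has norm at most
    [r], satisfies [j2^* Y = X0] as all other terms are orthogonal to [H], and
    [Y V1 = W Y] because [V1] on the right shifts the series
    ([intertwining_lift]).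

    Inner products enter through the real part of the Hermitian form, which
    determines the form and makes every estimate an inequality between real
    numbers. *)

(** * Semi-inner products *)

Section SemiInner.
Context {R : realType}.
Local Notation C := (complex R).
Local Open Scope complex_scope.
Implicit Types (V U : lmodType C).

(** The real parts of positive semidefinite Hermitian forms; [siJ] is what
    remains of complex sesquilinearity. *)
Record semi_inner {V} (s : V -> V -> R) : Prop := SemiInner {
  siC : forall x y, s x y = s y x ;
  siDl : forall x y z, s (x + y) z = s x z + s y z ;
  siZl : forall (a : R) x y, s (a%:C *: x) y = a * s x y ;
  siJ : forall c x y, s (c *: x) y = s x (Num.conj c *: y) ;
  si_ge0 : forall x, 0 <= s x x }.

Definition snorm {V} (s : V -> V -> R) (x : V) : R := Num.sqrt (s x x).

Lemma discriminant_le (a b c : R) : 0 <= a ->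
  (forall t, 0 <= a * t ^+ 2 - 2 * b * t + c) -> b ^+ 2 <= a * c.
Proof.
move=> a0 h; have [a1|a1] := eqVneq a 0.
  have [->|b0] := eqVneq b 0; first by rewrite a1 expr0n/= mul0r.
  have := h ((c + 1) / (2 * b)); rewrite a1 mul0r add0r.
  rewrite mulrC divfK ?mulf_neq0// ?pnatr_eq0//; lra.
have ap : 0 < a by rewrite lt0r a1.
have := h (b / a); have -> : a * (b / a) ^+ 2 - 2 * b * (b / a) + c = (a * c - b ^+ 2) / a.
  by field.
by rewrite pmulr_lge0 ?invr_gt0// subr_ge0.
Qed.

Section SemiInnerTheory.
Context {V : lmodType C} {s : V -> V -> R} (hs : semi_inner s).

Lemma siDr x y z : s x (y + z) = s x y + s x z.
Proof. by rewrite siC// siDl// !(siC hs x). Qed.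

Lemma siZr (a : R) x y : s x (a%:C *: y) = a * s x y.
Proof. by rewrite siC// siZl// siC. Qed.

Lemma siNl x y : s (- x) y = - s x y.
Proof.
have -> : - x = (-1)%:C *: x by rewrite rmorphN1 scaleN1r.
by rewrite siZl// mulN1r.
Qed.

Lemma siNr x y : s x (- y) = - s x y.
Proof. by rewrite siC// siNl siC. Qed.

Lemma si0l y : s 0 y = 0.
Proof. by rewrite -(subrr y) siDl// siNl subrr. Qed.

Lemma si0r y : s y 0 = 0.
Proof. by rewrite siC// si0l. Qed.

Lemma snorm_ge0 x : 0 <= snorm s x. Proof. exact: sqrtr_ge0. Qed.

Lemma sqr_snorm x : snorm s x ^+ 2 = s x x.
Proof. by rewrite sqr_sqrtr// si_ge0. Qed.

Lemma snorm0 : snorm s 0 = 0. Proof. by rewrite /snorm si0l sqrtr0. Qed.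

Lemma snormN x : snorm s (- x) = snorm s x.
Proof. by rewrite /snorm siNl siNr opprK. Qed.

Lemma si_sqrD x y : s (x + y) (x + y) = s x x + 2 * s x y + s y y.
Proof. rewrite siDl// !siDr (siC hs y x); ring. Qed.

Lemma cauchy_schwarz x y : `|s x y| <= snorm s x * snorm s y.
Proof.
rewrite -(ler_pXn2r (n := 2))// ?nnegrE ?normr_ge0 ?mulr_ge0 ?snorm_ge0//.
rewrite real_normK ?num_real// exprMn !sqr_snorm mulrC.
apply: discriminant_le; first exact: si_ge0.
move=> t; have := si_ge0 hs (x - t%:C *: y).
rewrite si_sqrD siNr siNl siNr siZr siZl// siZr; nra.
Qed.

Lemma cauchy_schwarz_le x y : s x y <= snorm s x * snorm s y.
Proof. exact: le_trans (ler_norm _) (cauchy_schwarz _ _). Qed.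

Lemma snormD x y : snorm s (x + y) <= snorm s x + snorm s y.
Proof.
rewrite -(ler_pXn2r (n := 2))// ?nnegrE ?addr_ge0 ?snorm_ge0//.
rewrite sqr_snorm si_sqrD -!sqr_snorm; have := cauchy_schwarz_le x y.
by nra.
Qed.

Lemma snormB x y : snorm s (x - y) <= snorm s x + snorm s y.
Proof. by rewrite -(snormN y) snormD. Qed.

Lemma snorm_sub x y : snorm s (x - y) = snorm s (y - x).
Proof. by rewrite -snormN opprB. Qed.

Lemma snormZ c x : snorm s (c *: x) = complex.Re `|c| * snorm s x.
Proof.
have nc : `|c| = (complex.Re `|c|)%:C by rewrite RRe_real ?normr_real.
have e : s (c *: x) (c *: x) = complex.Re `|c| ^+ 2 * s x x.
  rewrite siJ// scalerA.
  have -> : Num.conj c * c = (complex.Re `|c| ^+ 2)%:C.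
    by rewrite mulrC -normCK {1}nc rmorphXn.
  exact: siZr.
have c0 : 0 <= complex.Re `|c| by have := normr_ge0 c; rewrite lecE => /andP[].
by rewrite /snorm e sqrtrM ?sqr_ge0// sqrtr_sqr ger0_norm.
Qed.

Lemma snorm_le_of_sqr x (a : R) : 0 <= a -> s x x <= a * snorm s x -> snorm s x <= a.
Proof.
rewrite -sqr_snorm; have := snorm_ge0 x.
by rewrite le_eqVlt => /predU1P[<- //|x0]; rewrite expr2 ler_pM2r.
Qed.

(** Near-minimality of [u] for [s u u - 2 * phi u] forces, by varying [u] along
    [v], that [s u] and [phi] agree up to [e] in the dual seminorm. *)
Lemma approx_riesz (phi : V -> R) (M : R) :
  (forall x y, phi (x + y) = phi x + phi y) ->
  (forall (a : R) x, phi (a%:C *: x) = a * phi x) ->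
  (forall v, phi v <= M * snorm s v) ->
  forall e, 0 < e -> exists u, forall v, `|phi v - s u v| <= e * snorm s v.
Proof.
move=> phiD phiZ phiM e e0.
pose J u := s u u - 2 * phi u.
have Jlb u : - M ^+ 2 <= J u.
  rewrite /J -sqr_snorm; have := phiM u; have := snorm_ge0 u.
  have := sqr_ge0 (snorm s u - M); nra.
have infJ : has_inf (range J).
  split; first by exists (J 0), 0.
  by exists (- M ^+ 2) => _ [u _ <-].
have e20 : 0 < e ^+ 2 by rewrite exprn_gt0.
have [_ [u _ <-] hu] := inf_adherent e20 infJ.
exists u => v.
have Jlow w : inf (range J) <= J w.
  by apply: ge_inf; [case: infJ | exists w].
rewrite -(ler_pXn2r (n := 2))// ?nnegrE ?normr_ge0 ?mulr_ge0 ?snorm_ge0 ?(ltW e0)//.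
rewrite real_normK ?num_real// exprMn sqr_snorm mulrC.
apply: discriminant_le; first exact: si_ge0.
move=> t; have := Jlow (u + t%:C *: v).
move: hu; rewrite /J si_sqrD phiD phiZ siZr siZl// siZr; nra.
Qed.

End SemiInnerTheory.

End SemiInner.

(** * The real inner product of a Hilbert space *)

Section HilbertReal.
Context {R : realType}.
Local Open Scope complex_scope.
Implicit Types (H K : hilbertType R).

Definition rdot {H} (x y : H) : R := complex.Re (hdot x y).

Lemma hdotC {H} (x y : H) : hdot x y = Num.conj (hdot y x).
Proof. by rewrite (hermC (@hdot R H)) expr0 mul1r. Qed.

Lemma Re_conj (z : R[i]) : complex.Re (Num.conj z) = complex.Re z.
Proof. by case: z. Qed.

Lemma Re_realM (a : R) (z : R[i]) : complex.Re (a%:C * z) = a * complex.Re z.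
Proof. by case: z => x y /=; rewrite mul0r subr0. Qed.

Lemma hdotZr {H} (c : R[i]) (x y : H) : hdot x (c *: y) = Num.conj c * hdot x y.
Proof. by rewrite hdotC linearZl_LR/= rmorphM/= -hdotC. Qed.

Lemma rdot_semi_inner {H} : semi_inner (@rdot H).
Proof.
split; rewrite /rdot.
- by move=> x y; rewrite hdotC Re_conj.
- by move=> x y z; rewrite linearDl/=; case: (hdot x z) (hdot y z) => [? ?] [? ?].
- by move=> a x y; rewrite linearZl_LR/= Re_realM.
- by move=> c x y; rewrite linearZl_LR/= hdotZr conjCK.
- move=> x; rewrite hdotxx; have : 0 <= `|x| ^+ 2 by rewrite exprn_ge0.
  by rewrite lecE => /andP[].
Qed.

Local Notation hn := (snorm rdot).

Lemma normE {H} (x : H) : `|x| = (hn x)%:C.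
Proof.
have nx : `|x| = (complex.Re `|x|)%:C by rewrite RRe_real ?normr_real.
have n0 : 0 <= complex.Re `|x|.
  by have := normr_ge0 x; rewrite lecE => /andP[].
rewrite {1}nx; congr (_ %:C).
by rewrite /snorm /rdot hdotxx nx -rmorphXn/= sqrtr_sqr ger0_norm.
Qed.

Lemma hn_eq0 {H} (x : H) : hn x <= 0 -> x = 0.
Proof.
move=> h; apply/eqP; rewrite -normr_eq0 normE; apply/eqP.
by congr (_ %:C); apply/le_anti; rewrite h snorm_ge0.
Qed.

Lemma eq_hn_small {H} (x y : H) : (forall e, 0 < e -> hn (x - y) <= e) -> x = y.
Proof.
move=> h; apply/subr0_eq/hn_eq0; apply/ler_addgt0Pr => e e0.
by rewrite add0r h.
Qed.

Lemma rdot_inj {H} (y z : H) : (forall x, rdot x y = rdot x z) -> y = z.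
Proof.
move=> h; apply/subr0_eq/hn_eq0.
rewrite /snorm (siDr rdot_semi_inner) (siNr rdot_semi_inner) h subrr.
by rewrite sqrtr0.
Qed.

(** The real part of a Hermitian form determines the form. *)
Lemma hdot_rdot {H K} (f : {linear K -> H}) (y : H) (z : K) :
  (forall x, rdot (f x) y = rdot x z) -> forall x, hdot (f x) y = hdot x z.
Proof.
move=> h x; have := h x; have := h ('i%C *: x).
rewrite /rdot linearZ !linearZl_LR/=.
case: (hdot (f x) y) (hdot x z) => [a b] [c d] /=.
by rewrite !mul0r !mul1r !sub0r => /oppr_inj -> ->.
Qed.

(** Norm convergence with real rather than complex tolerances. *)
Definition tends_to {H} (u : nat -> H) (l : H) :=
  forall e : R, 0 < e -> exists N, forall n, (N <= n)%N -> hn (u n - l) <= e.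

Lemma hilbert_complete {H} (u : nat -> H) :
  (forall e : R, 0 < e -> exists N, forall m n, (N <= m)%N -> (N <= n)%N ->
     hn (u m - u n) <= e) ->
  exists l, tends_to u l.
Proof.
move=> hu; have : cvg (u @ \oo)%classic.
  apply/cauchy_cvgP/cauchyP => e e0.
  have er : e = (complex.Re e)%:C by rewrite RRe_real// gtr0_real.
  have re0 : 0 < complex.Re e by rewrite -ltcR -er.
  have [N hN] := hu (complex.Re e / 2) (divr_gt0 re0 (ltr0Sn _ 1)).
  exists (u N); exists N => // n /= Nn.
  rewrite -ball_normE/= normE er ltcR.
  by apply: le_lt_trans (hN _ _ (leqnn N) Nn) _; lra.
move/cvg_ex => [l /cvgrPdist_le hl]; exists l => e e0.
have [|N _ hN] := hl e%:C; first by rewrite ltcR.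
exists N => n Nn; have := hN n Nn; rewrite normE lecR.
by rewrite (snorm_sub rdot_semi_inner).
Qed.

End HilbertReal.

(** * Riesz representation and contractive extension *)

Local Notation hn := (snorm rdot).

Section Extension.
Context {R : realType}.
Local Open Scope complex_scope.
Implicit Types (H K F : hilbertType R) (V U X : lmodType R[i]).

Lemma half_gt0 (e : R) : 0 < e -> 0 < e / 2. Proof. by lra. Qed.

Lemma third_gt0 (e : R) : 0 < e -> 0 < e / 3. Proof. by lra. Qed.

Lemma small_factor (a e : R) : 0 <= a -> 0 < e -> exists2 d, 0 < d & d * (a + 1) = e.
Proof.
move=> a0 e0; exists (e / (a + 1)); first by rewrite divr_gt0//; lra.
by rewrite divfK// gt_eqF//; lra.
Qed.

Lemma inv_nat_small (e : R) : 0 < e ->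
  exists N, forall n, (N <= n)%N -> (n.+1%:R : R)^-1 <= e.
Proof.
move=> e0; exists (Num.bound e^-1) => n Nn.
rewrite -(invrK e) lef_pV2 ?posrE ?invr_gt0 ?ltr0n//.
apply/ltW/(lt_le_trans (archi_boundP _)); first by rewrite invr_ge0 ltW.
by rewrite ler_nat ltnW.
Qed.

Lemma linear_of_fun V U (f : V -> U) : linear f ->
  exists g : {linear V -> U}, forall x, g x = f x.
Proof.
move=> lf; pose m := GRing.isLinear.Build _ _ _ _ f lf.
by exists (HB.pack f m : {linear V -> U}).
Qed.

Lemma semi_inner_pullback V U (s : V -> V -> R) (m : {linear U -> V}) :
  semi_inner s -> semi_inner (fun x y => s (m x) (m y)).
Proof.
move=> hs; split.
- by move=> x y; rewrite (siC hs).
- by move=> x y z; rewrite linearD (siDl hs).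
- by move=> a x y; rewrite linearZ (siZl hs).
- by move=> c x y; rewrite !linearZ (siJ hs).
- by move=> x; apply: (si_ge0 hs).
Qed.

Lemma snorm_le_dual V (s : V -> V -> R) (w : V) (e : R) : semi_inner s -> 0 <= e ->
  (forall v, `|s w v| <= e * snorm s v) -> snorm s w <= e.
Proof.
move=> hs e0 hw; apply: (snorm_le_of_sqr hs e0).
exact: le_trans (ler_norm _) (hw w).
Qed.

(** [s] need not be complete, but its approximate Riesz vectors form a Cauchy
    net, which any map [b] dominated by [s] carries into a complete space. *)
Lemma riesz_limit V F (s : V -> V -> R) (b : {linear V -> F})
    (phi : V -> R) (M : R) : semi_inner s ->
  (forall u, hn (b u) <= snorm s u) ->
  (forall x y, phi (x + y) = phi x + phi y) ->
  (forall (a : R) x, phi (a%:C *: x) = a * phi x) ->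
  (forall v, phi v <= M * snorm s v) ->
  exists l : F, forall e, 0 < e ->
    exists u, (forall v, `|phi v - s u v| <= e * snorm s v) /\ hn (l - b u) <= e.
Proof.
move=> hs hb phiD phiZ phiM.
have ap n : exists u, forall v, `|phi v - s u v| <= (n.+1%:R)^-1 * snorm s v.
  by apply: (approx_riesz hs phiD phiZ phiM); rewrite invr_gt0 ltr0n.
have [u hu] := choice ap.
have cu m n : hn (b (u m) - b (u n)) <= (m.+1%:R)^-1 + (n.+1%:R)^-1.
  rewrite -linearB; apply: le_trans (hb _) _.
  apply: (snorm_le_dual hs); first by rewrite addr_ge0// invr_ge0 ler0n.
  move=> v; have -> : s (u m - u n) v = (phi v - s (u n) v) - (phi v - s (u m) v).
    by rewrite (siDl hs) (siNl hs); ring.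
  apply: le_trans (ler_normB _ _) _; rewrite mulrDl addrC.
  by apply: lerD; apply: hu.
have [|l hl] := hilbert_complete (u := b \o u).
  move=> e e0; have [N hN] := inv_nat_small (half_gt0 e0).
  exists N => m n Nm Nn; apply: le_trans (cu m n) _.
  by rewrite (splitr e) lerD ?hN.
exists l => e e0; have [N hN] := inv_nat_small e0; have [N' hN'] := hl e e0.
exists (u (maxn N N')); split; last first.
  by rewrite (snorm_sub rdot_semi_inner); apply: hN'; rewrite leq_maxr.
move=> v; apply: le_trans (hu _ _) _.
by apply: ler_wpM2r; [apply: snorm_ge0 | apply/hN/leq_maxl].
Qed.

Lemma riesz H (phi : H -> R) (M : R) :
  (forall x y, phi (x + y) = phi x + phi y) ->
  (forall (a : R) x, phi (a%:C *: x) = a * phi x) ->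
  (forall v, phi v <= M * hn v) ->
  exists z, forall v, phi v = rdot v z.
Proof.
move=> phiD phiZ phiM.
have [z hz] := @riesz_limit H H rdot idfun phi M rdot_semi_inner
  (fun u => lexx _) phiD phiZ phiM.
exists z => v; apply/subr0_eq/eqP; rewrite -normr_le0.
apply/ler_addgt0Pr => e e0; rewrite add0r.
have v0 : 0 <= 2 * hn v by rewrite mulr_ge0 ?snorm_ge0.
have [d d0 de] := small_factor v0 e0; have [u [h1 h2]] := hz d d0.
have -> : phi v - rdot v z = (phi v - rdot u v) - rdot (z - u) v.
  rewrite (siDl rdot_semi_inner) (siNl rdot_semi_inner) (siC rdot_semi_inner v z).
  by ring.
apply: le_trans (ler_normB _ _) _.
have h3 := cauchy_schwarz rdot_semi_inner (z - u) v.
have : hn (z - u) * hn v <= d * hn v by rewrite ler_wpM2r// snorm_ge0.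
have := h1 v; nra.
Qed.

(** Orthogonal projection, for the semi-inner product [s], onto the closure of
    the range of [m], followed by [b].  The domain of [s] is not complete, so the
    projection itself need not exist; the vectors [m u] that approximate it
    do, and [b] turns them into a convergent family.  The last clause transfers
    estimates from [b] to [B] without loss in the constants. *)
Lemma contractive_extension U X F (s : X -> X -> R)
    (m : {linear U -> X}) (b : {linear U -> F}) : semi_inner s ->
  (forall u, hn (b u) <= snorm s (m u)) ->
  exists B : {linear X -> F}, (forall u, B (m u) = b u) /\
    forall x e, 0 < e ->
      exists u, hn (B x - b u) <= e /\ snorm s (m u) <= snorm s x + e.
Proof.
move=> hs hb; pose s' u v := s (m u) (m v).
have hs' : semi_inner s' by apply: semi_inner_pullback.
(* [l] is the image under [b] of the projection of [x] *)
pose proj x l := forall e : R, 0 < e -> exists u,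
  (forall v, `|s (x - m u) (m v)| <= e * snorm s (m v)) /\ hn (l - b u) <= e.
have proj_ex x : exists l, proj x l.
  have [|||l hl] := @riesz_limit U F s' b (fun v => s x (m v)) (snorm s x) hs' hb.
  - by move=> u v; rewrite linearD (siDr hs).
  - by move=> a v; rewrite linearZ (siZr hs).
  - by move=> v; exact: cauchy_schwarz_le.
  exists l => e e0; have [u [h1 h2]] := hl e e0.
  by exists u; split=> // v; rewrite (siDl hs) (siNl hs); apply: h1.
have proj_lin c x y l l' : proj x l -> proj y l' -> proj (c *: x + y) (c *: l + l').
  move=> hx hy e e0; pose a := complex.Re `|c|.
  have a0 : 0 <= a by have := normr_ge0 c; rewrite lecE => /andP[].
  have [d d0 de] := small_factor a0 e0.
  have [u [u1 u2]] := hx _ d0; have [v [v1 v2]] := hy _ d0.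
  exists (c *: u + v); split=> [w|].
    have -> : c *: x + y - m (c *: u + v) = c *: (x - m u) + (y - m v).
      by rewrite linearP scalerBr opprD addrACA.
    rewrite (siDl hs) (siJ hs) -linearZ.
    apply: le_trans (ler_normD _ _) _.
    have := u1 (Num.conj c *: w); have := v1 w.
    rewrite linearZ (snormZ hs) norm_conjC -/a.
    by have := snorm_ge0 (s := s) (m w); nra.
  have -> : c *: l + l' - b (c *: u + v) = c *: (l - b u) + (l' - b v).
    by rewrite linearP scalerBr opprD addrACA.
  apply: le_trans (snormD rdot_semi_inner _ _) _.
  by rewrite (snormZ rdot_semi_inner) -/a; nra.
have proj_bound x l e : proj x l -> 0 < e ->
    exists u, hn (l - b u) <= e /\ snorm s (m u) <= snorm s x + e.
  move=> /(_ e) h e0; have [u [h1 h2]] := h e0; exists u; split=> //.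
  apply: (snorm_le_dual hs').
    by have := snorm_ge0 (s := s) x; lra.
  move=> v; have -> : s' u v = s x (m v) - s (x - m u) (m v).
    by rewrite (siDl hs) (siNl hs) /s'; ring.
  apply: le_trans (ler_normB _ _) _; rewrite mulrDl.
  by apply: lerD; [apply: cauchy_schwarz | apply: h1].
have proj0 l : proj 0 l -> l = 0.
  move=> h; apply: eq_hn_small => e e0; rewrite subr0.
  have [u [h1 h2]] := proj_bound _ _ _ h (third_gt0 e0).
  rewrite -(subrK (b u) l); apply: le_trans (snormD rdot_semi_inner _ _) _.
  by move: h2 (hb u); rewrite (snorm0 hs); lra.
have proj_uniq x l l' : proj x l -> proj x l' -> l = l'.
  move=> h h'; apply/eqP; rewrite eq_sym -subr_eq0; apply/eqP/proj0.
  have := proj_lin (-1) _ _ _ _ h h'.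
  by rewrite !scaleN1r addNr addrC.
have [f hf] := choice proj_ex.
have [B hB] : exists B : {linear X -> F}, forall x, B x = f x.
  apply: linear_of_fun => c x y; apply: (proj_uniq (c *: x + y)); first exact: hf.
  by apply: proj_lin; apply: hf.
exists B; split=> [u|x e e0]; last first.
  by rewrite hB; apply: proj_bound.
rewrite hB; apply: (proj_uniq (m u)); first exact: hf.
move=> e e0; exists u; rewrite !subrr (snorm0 rdot_semi_inner); split=> [v|]; last exact: ltW.
by rewrite (si0l hs) normr0 mulr_ge0 ?snorm_ge0// ltW.
Qed.

Lemma contractive_extension_bound U X F (s : X -> X -> R)
    (m : {linear U -> X}) (b : {linear U -> F}) (B : X -> F) :
  (forall u, hn (b u) <= snorm s (m u)) ->
  (forall x e, 0 < e ->
      exists u, hn (B x - b u) <= e /\ snorm s (m u) <= snorm s x + e) ->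
  forall x, hn (B x) <= snorm s x.
Proof.
move=> hb hB x; apply/ler_addgt0Pr => e e0.
have [u [h1 h2]] := hB x _ (half_gt0 e0).
rewrite -(subrK (b u) (B x)); apply: le_trans (snormD rdot_semi_inner _ _) _.
by have := hb u; lra.
Qed.

End Extension.

(** * Norm limits *)

Section Limits.
Context {R : realType}.
Local Open Scope complex_scope.
Implicit Types (H K : hilbertType R).

Lemma tends_to_uniq {H} (u : nat -> H) (l l' : H) :
  tends_to u l -> tends_to u l' -> l = l'.
Proof.
move=> h h'; apply: eq_hn_small => e e0.
have [N hN] := h _ (half_gt0 e0); have [N' hN'] := h' _ (half_gt0 e0).
have := hN _ (leq_maxl N N'); have := hN' _ (leq_maxr N N').
set n := maxn _ _ => h1 h2.
have -> : l - l' = (u n - l') - (u n - l) by rewrite opprB [RHS]addrC addrA subrK.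
by apply: le_trans (snormB rdot_semi_inner _ _) _; lra.
Qed.

Lemma tends_to_lin {H} c (u v : nat -> H) (l l' : H) :
  tends_to u l -> tends_to v l' -> tends_to (fun n => c *: u n + v n) (c *: l + l').
Proof.
move=> h h' e e0; pose a := complex.Re `|c|.
have a0 : 0 <= a by have := normr_ge0 c; rewrite lecE => /andP[].
have [d d0 de] := small_factor a0 e0.
have [N hN] := h _ d0; have [N' hN'] := h' _ d0.
exists (maxn N N') => n; rewrite geq_max => /andP[/hN h1 /hN' h2].
rewrite opprD addrACA -scalerBr.
apply: le_trans (snormD rdot_semi_inner _ _) _.
by rewrite (snormZ rdot_semi_inner) -/a; nra.
Qed.

Lemma tends_to_const {H} (l : H) : tends_to (fun=> l) l.
Proof.
by move=> e e0; exists 0%N => n _; rewrite subrr (snorm0 rdot_semi_inner) ltW.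
Qed.

Lemma tends_toD {H} (u v : nat -> H) (l l' : H) :
  tends_to u l -> tends_to v l' -> tends_to (fun n => u n + v n) (l + l').
Proof.
move=> h h'; have := tends_to_lin 1 h h'; rewrite scale1r.
by under eq_fun do rewrite scale1r.
Qed.

Lemma tends_to_shift {H} (u : nat -> H) (l : H) :
  tends_to (fun n => u n.+1) l <-> tends_to u l.
Proof.
split=> h e /h [N hN]; last by exists N => n Nn; apply/hN/leqW.
by exists N.+1 => -[//|n] Nn; apply: hN.
Qed.

Lemma tends_to_map {H K} (f : {linear H -> K}) (u : nat -> H) (l : H) :
  (forall x, hn (f x) <= hn x) -> tends_to u l -> tends_to (f \o u) (f l).
Proof.
move=> hf hu e /hu [N hN]; exists N => n Nn /=; rewrite -linearB.
exact: le_trans (hf _) (hN n Nn).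
Qed.

Lemma tends_to_rdot {H} (u : nat -> H) (l y : H) (a : R) :
  tends_to u l -> (forall e, 0 < e -> exists N, forall n, (N <= n)%N ->
     `|rdot (u n) y - a| <= e) -> rdot l y = a.
Proof.
move=> hu ha; apply/eqP; rewrite -subr_eq0 -normr_le0.
apply/ler_addgt0Pr => e e0; rewrite add0r.
have y0 := snorm_ge0 (s := rdot) y.
have [d d0 de] := small_factor y0 e0.
have [N hN] := hu _ d0; have [N' hN'] := ha _ d0.
have := hN _ (leq_maxl N N'); have := hN' _ (leq_maxr N N').
set n := maxn _ _ => h1 h2.
have -> : rdot l y - a = (rdot (u n) y - a) - rdot (u n - l) y.
  by rewrite (siDl rdot_semi_inner) (siNl rdot_semi_inner); ring.
apply: le_trans (ler_normB _ _) _.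
by have := cauchy_schwarz rdot_semi_inner (u n - l) y; nra.
Qed.

Lemma tends_to_rdot_cst {H} (u : nat -> H) (l y : H) (a : R) :
  tends_to u l -> (forall n, rdot (u n) y = a) -> rdot l y = a.
Proof.
move=> hu h; apply: (tends_to_rdot hu) => e e0; exists 0%N => n _.
by rewrite h subrr normr0 ltW.
Qed.

Lemma tends_to_hn_le {H} (u : nat -> H) (l : H) (M : R) :
  tends_to u l -> (forall n, hn (u n) <= M) -> hn l <= M.
Proof.
move=> hu h; apply/ler_addgt0Pr => e /hu [N hN].
have := hN N (leqnn N); rewrite (snorm_sub rdot_semi_inner) => h1.
rewrite -(subrK (u N) l); apply: le_trans (snormD rdot_semi_inner _ _) _.
by have := h N; lra.
Qed.

Lemma linear_limit {H K} (f : nat -> {linear H -> K}) :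
  (forall x, exists l, tends_to (fun n => f n x) l) ->
  exists g : {linear H -> K}, forall x, tends_to (fun n => f n x) (g x).
Proof.
move=> /choice[g hg]; have [G hG] : exists G : {linear H -> K}, forall x, G x = g x.
  apply: linear_of_fun => c x y; apply: (tends_to_uniq (hg _)).
  under eq_fun do rewrite linearP.
  exact: tends_to_lin.
by exists G => x; rewrite hG.
Qed.

Lemma monotone_cauchy (b : nat -> R) (M : R) : {homo b : m n / (m <= n)%N >-> m <= n} ->
  (forall n, b n <= M) ->
  forall e, 0 < e -> exists N, forall n, (N <= n)%N -> b n - b N <= e.
Proof.
move=> bh bM e e0; have hs : has_sup (range b).
  by split; [exists (b 0%N), 0%N | exists M => _ [n _ <-]].
have [_ [N _ <-] hN] := sup_adherent e0 hs.
exists N => n Nn; have : b n <= sup (range b).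
  by apply: ub_le_sup; [case: hs | exists n].
by lra.
Qed.

End Limits.

(** * Square roots and the defect operator *)

Section Operators.
Context {R : realType}.
Local Open Scope complex_scope.
Implicit Types (H K : hilbertType R).

Lemma adjoint_ex {H K} (f : {linear H -> K}) (M : R) :
  (forall x, hn (f x) <= M * hn x) ->
  exists g : {linear K -> H}, forall x y, rdot (f x) y = rdot x (g y).
Proof.
move=> hf.
have /choice[g hg] y : exists z, forall x, rdot (f x) y = rdot x z.
  apply: (@riesz _ H (fun x => rdot (f x) y) (M * hn y)).
  - by move=> u v; rewrite linearD (siDl rdot_semi_inner).
  - by move=> a v; rewrite linearZ (siZl rdot_semi_inner).
  - move=> v; apply: le_trans (cauchy_schwarz_le rdot_semi_inner _ _) _.
    have := hf v; have := snorm_ge0 (s := rdot) y; nra.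
have [G hG] : exists G : {linear K -> H}, forall x, G x = g x.
  apply: linear_of_fun => c x y; apply: rdot_inj => v.
  have J (u w : H) : rdot u (c *: w) = rdot (Num.conj c *: u) w.
    by rewrite (siJ rdot_semi_inner) conjCK.
  have J' (u w : K) : rdot u (c *: w) = rdot (Num.conj c *: u) w.
    by rewrite (siJ rdot_semi_inner) conjCK.
  by rewrite !(siDr rdot_semi_inner) J -!hg (siDr rdot_semi_inner) J' linearZ.
by exists G => x y; rewrite hG.
Qed.

Section SquareRoot.
Context {H : hilbertType R} (A : {linear H -> H}).
Hypothesis A_sa : forall x y, rdot (A x) y = rdot x (A y).
Hypothesis A_le1 : forall x, hn (A x) <= hn x.

(** Iterates for [L = (A + L^2) / 2], whose solution is [L = 1 - (1 - A)^(1/2)]. *)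
Fixpoint sqrt_iter (n : nat) : {linear H -> H} :=
  if n is m.+1 then (2^-1)%:C \*: (A \+ (sqrt_iter m \o sqrt_iter m)) else \0.

(** The same iteration for [A = 1]: it dominates [sqrt_iter] in norm, and so do
    its increments, which are summable because it is monotone and bounded. *)
Fixpoint sqrt_bound (n : nat) : R :=
  if n is m.+1 then 2^-1 * (1 + sqrt_bound m ^+ 2) else 0.

Lemma sqrt_iterS n x :
  sqrt_iter n.+1 x = (2^-1)%:C *: (A x + sqrt_iter n (sqrt_iter n x)).
Proof. by []. Qed.

Lemma sqrt_iter_sa n x y : rdot (sqrt_iter n x) y = rdot x (sqrt_iter n y).
Proof.
elim: n x y => [|n IH] x y; first by rewrite (si0l rdot_semi_inner) (si0r rdot_semi_inner).
rewrite !sqrt_iterS (siZl rdot_semi_inner) (siZr rdot_semi_inner).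
by rewrite (siDl rdot_semi_inner) (siDr rdot_semi_inner) A_sa !IH.
Qed.

Lemma sqrt_iter_comm (f : {linear H -> H}) :
  (forall x, f (A x) = A (f x)) ->
  forall n x, f (sqrt_iter n x) = sqrt_iter n (f x).
Proof.
move=> fA; elim=> [|n IH] x; first exact: linear0.
by rewrite !sqrt_iterS linearZ linearD fA !IH.
Qed.

Lemma sqrt_iter_commA n x : sqrt_iter n (A x) = A (sqrt_iter n x).
Proof. by rewrite (sqrt_iter_comm (f := A)). Qed.

Lemma sqrt_bound01 n : 0 <= sqrt_bound n <= 1.
Proof. by elim: n => [|n /andP[h h']] /=; [lra | nra]. Qed.

Lemma hn_realZ (a : R) (x : H) : 0 <= a -> hn (a%:C *: x) = a * hn x.
Proof.
move=> a0; rewrite (snormZ rdot_semi_inner) ger0_norm ?lecR//.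
Qed.

Lemma sqrt_iter_le n x : hn (sqrt_iter n x) <= sqrt_bound n * hn x.
Proof.
elim: n x => [|n IH] x; first by rewrite /= (snorm0 rdot_semi_inner) mul0r.
rewrite sqrt_iterS hn_realZ ?invr_ge0 ?ler0n//= -mulrA ler_wpM2l ?invr_ge0 ?ler0n//.
apply: le_trans (snormD rdot_semi_inner _ _) _.
have := A_le1 x; have := IH x; have := IH (sqrt_iter n x).
by have := sqrt_bound01 n; nra.
Qed.

(** As iterates commute, the increment factors as
    [(P + Q) (P - Q) / 2], and the bounds factor in the same way. *)
Lemma sqrt_iter_step n x :
  hn (sqrt_iter n.+1 x - sqrt_iter n x) <= (sqrt_bound n.+1 - sqrt_bound n) * hn x.
Proof.
elim: n x => [|n IH] x; first by rewrite !subr0 sqrt_iter_le.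
set P := sqrt_iter n.+1; set Q := sqrt_iter n in IH *.
have -> : sqrt_iter n.+2 x - P x = (2^-1)%:C *: (P ((P x - Q x)) + Q (P x - Q x)).
  rewrite sqrt_iterS [X in _ - X]sqrt_iterS -scalerBr -/P -/Q; congr (_ *: _).
  have PQ : P (Q x) = Q (P x).
    by apply: sqrt_iter_comm => y; rewrite sqrt_iter_commA.
  by rewrite !linearB PQ addrA subrK opprD addrACA subrr add0r.
rewrite hn_realZ ?invr_ge0 ?ler0n//.
apply: le_trans (ler_wpM2l _ (snormD rdot_semi_inner _ _)) _; first by rewrite invr_ge0 ler0n.
have hP := sqrt_iter_le n.+1 (P x - Q x); have hQ := sqrt_iter_le n (P x - Q x).
have hd := IH x; have b1 := sqrt_bound01 n.+1; have b0 := sqrt_bound01 n.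
rewrite [sqrt_bound n.+2]/= -/(sqrt_bound n.+1) -/P -/Q in hP hQ hd *.
set b' := sqrt_bound n.+1 in hP hd b1 *; set b := sqrt_bound n in hQ hd b0 *.
have bE : b' = 2^-1 * (1 + b ^+ 2) by [].
have x0 := snorm_ge0 (s := rdot) x; set d := hn (P x - Q x) in hP hQ hd *.
have : (b' + b) * d <= (b' + b) * ((b' - b) * hn x) by rewrite ler_wpM2l//; lra.
have -> : 2^-1 * (1 + b' ^+ 2) - b' = 2^-1 * (b' ^+ 2 - b ^+ 2) by rewrite [X in _ - X]bE; ring.
by lra.
Qed.

Lemma sqrt_bound_homo : {homo sqrt_bound : m n / (m <= n)%N >-> m <= n}.
Proof.
apply: (@homo_leq _ _ (fun a b : R => a <= b)) => // [a b c|n]; first exact: le_trans.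
by have := sqr_ge0 (sqrt_bound n - 1); rewrite /=; nra.
Qed.

Lemma sqrt_iter_dist N n x : (N <= n)%N ->
  hn (sqrt_iter n x - sqrt_iter N x) <= (sqrt_bound n - sqrt_bound N) * hn x.
Proof.
elim: n => [|n IH]; first by rewrite leqn0 => /eqP ->; rewrite !subrr (snorm0 rdot_semi_inner) mul0r.
rewrite leq_eqVlt => /predU1P[->|]; first by rewrite !subrr (snorm0 rdot_semi_inner) mul0r.
rewrite ltnS => /IH h.
have -> : sqrt_iter n.+1 x - sqrt_iter N x =
  (sqrt_iter n.+1 x - sqrt_iter n x) + (sqrt_iter n x - sqrt_iter N x).
  by rewrite addrA subrK.
apply: le_trans (snormD rdot_semi_inner _ _) _.
by have := sqrt_iter_step n x; lra.
Qed.

Lemma sqrt_iter_cvg : exists L : {linear H -> H},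
  forall x, tends_to (fun n => sqrt_iter n x) (L x).
Proof.
apply: linear_limit => x; apply: hilbert_complete => e e0.
have x0 := snorm_ge0 (s := rdot) x.
have x2 : 0 <= 2 * hn x by lra.
have [d d0 de] := small_factor x2 e0.
have [|N hN] := @monotone_cauchy _ sqrt_bound 1 sqrt_bound_homo _ _ d0.
  by move=> n; case/andP: (sqrt_bound01 n).
exists N => m n Nm Nn.
have -> : sqrt_iter m x - sqrt_iter n x =
  (sqrt_iter m x - sqrt_iter N x) - (sqrt_iter n x - sqrt_iter N x).
  by rewrite opprB addrA subrK.
apply: le_trans (snormB rdot_semi_inner _ _) _.
have := sqrt_iter_dist x Nm; have := sqrt_iter_dist x Nn.
by have := hN _ Nm; have := hN _ Nn; nra.
Qed.

(** The limit [L] of the iteration is self-adjoint with [2 L = A + L^2], so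
    [D = 1 - L] satisfies [D^2 = 1 - A]. *)
Lemma sqrt_one_sub : exists D : {linear H -> H},
  forall x, rdot (D x) (D x) = rdot x x - rdot x (A x).
Proof.
have [L hL] := sqrt_iter_cvg.
have L_sa x y : rdot (L x) y = rdot x (L y).
  apply: (tends_to_rdot (hL x)) => e e0.
  have x0 := snorm_ge0 (s := rdot) x.
  have [d d0 de] := small_factor x0 e0.
  have [N hN] := hL y _ d0; exists N => n /hN h.
  rewrite sqrt_iter_sa -(siNr rdot_semi_inner) -(siDr rdot_semi_inner).
  by apply: le_trans (cauchy_schwarz rdot_semi_inner _ _) _; nra.
have LL x : L x + L x = A x + L (L x).
  apply: (@tends_to_uniq _ _ (fun n => sqrt_iter n.+1 x + sqrt_iter n.+1 x)).
    have h := (tends_to_shift (fun n => sqrt_iter n x) _).2 (hL x).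
    exact: (tends_toD h h).
  have -> : (fun n => sqrt_iter n.+1 x + sqrt_iter n.+1 x) =
      fun n => A x + sqrt_iter n (sqrt_iter n x).
    apply/funext => n; rewrite !sqrt_iterS -scalerDl -rmorphD/=.
    have -> : 2^-1 + 2^-1 = 1 :> R by lra.
    by rewrite scale1r.
  apply: tends_toD; first exact: tends_to_const.
  move=> e e0; have [N hN] := hL x _ (half_gt0 e0).
  have [N' hN'] := hL (L x) _ (half_gt0 e0).
  exists (maxn N N') => n; rewrite geq_max => /andP[/hN h1 /hN' h2].
  have -> : sqrt_iter n (sqrt_iter n x) - L (L x) =
    sqrt_iter n (sqrt_iter n x - L x) + (sqrt_iter n (L x) - L (L x)).
    by rewrite linearB addrA subrK.
  apply: le_trans (snormD rdot_semi_inner _ _) _.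
  have := sqrt_iter_le n (sqrt_iter n x - L x); have := sqrt_bound01 n.
  have := snorm_ge0 (s := rdot) (sqrt_iter n x - L x); nra.
exists (idfun \- L) => x /=.
rewrite (si_sqrD rdot_semi_inner) (siNr rdot_semi_inner) (siNl rdot_semi_inner).
rewrite (siNr rdot_semi_inner) opprK (L_sa x (L x)).
have -> : L (L x) = L x + L x - A x by rewrite LL addrC addrA addNr add0r.
rewrite !(siDr rdot_semi_inner) (siNr rdot_semi_inner); ring.
Qed.

End SquareRoot.

Lemma contraction_adjoint {H K} (f : {linear H -> K}) (g : {linear K -> H}) :
  (forall x, hn (f x) <= hn x) ->
  (forall x y, rdot (f x) y = rdot x (g y)) -> forall y, hn (g y) <= hn y.
Proof.
move=> hf hfg y; apply: (snorm_le_dual rdot_semi_inner (snorm_ge0 _)) => v.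
rewrite (siC rdot_semi_inner) -hfg mulrC.
apply: le_trans (cauchy_schwarz rdot_semi_inner _ _) _.
by rewrite ler_wpM2r// snorm_ge0.
Qed.

Lemma defect_operator {H K} (S : {linear H -> K}) : (forall x, hn (S x) <= hn x) ->
  exists D : {linear H -> H},
    forall x, rdot (D x) (D x) = rdot x x - rdot (S x) (S x).
Proof.
move=> hS; have [|S' hS'] := @adjoint_ex _ _ S 1; first by move=> x; rewrite mul1r.
have S'_le := contraction_adjoint hS hS'.
have [||D hD] := @sqrt_one_sub _ (S' \o S).
- move=> x y /=; rewrite -hS' (siC rdot_semi_inner) -hS'.
  exact: siC rdot_semi_inner _ _.
- by move=> x; apply: le_trans (S'_le _) (hS x).
by exists D => x; rewrite hD/= hS'.
Qed.

End Operators.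

(** * The sequence of defect components *)

Section DefectSequence.
Context {R : realType}.
Local Open Scope complex_scope.
Context {H K : hilbertType R} (V : {linear K -> K}).

(** The right-hand side bounds [rdot (c u) (c u)] by [s (V u) (V u)]: along the
    range of [V], the map [V u |-> c u] is a contraction for [s]. *)
Definition defect_identity (s : K -> K -> R) (c : {linear K -> H}) :=
  semi_inner s /\ forall u, s (V u) (V u) = s u u + rdot (c u) (c u).

Definition defect_sub (s : K -> K -> R) (c : {linear K -> H}) : K -> K -> R :=
  fun x y => s x y - rdot (c x) (c y).

(** Since [c' V = c], subtracting the form of [c'] cancels the term of [c] in
    [s (V u) (V u)] and adds that of [c'] to [s u u]; positivity of the new form
    is the norm bound on the extension [c']. *)
Lemma defect_step s c : defect_identity s c ->
  exists c' : {linear K -> H}, (forall u, c' (V u) = c u) /\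
    defect_identity (defect_sub s c') c'.
Proof.
move=> [hs hV].
have hc u : hn (c u) <= snorm s (V u).
  by rewrite /snorm ler_wsqrtr// hV lerDr (si_ge0 hs).
have [c' [c'V c'_approx]] := contractive_extension hs hc.
have c'_le := contractive_extension_bound hc c'_approx.
exists c'; split=> //; split; last first.
  by move=> u; rewrite /defect_sub hV c'V subrK addrK.
have hr := @rdot_semi_inner R H.
split; rewrite /defect_sub.
- by move=> x y; rewrite (siC hs) (siC hr).
- by move=> x y z; rewrite linearD (siDl hs) (siDl hr); ring.
- by move=> a x y; rewrite linearZ (siZl hs) (siZl hr); ring.
- by move=> a x y; rewrite !linearZ (siJ hs) (siJ hr).
- move=> x; rewrite subr_ge0 -(sqr_snorm hr) -(sqr_snorm hs).
  by rewrite ler_sqr ?nnegrE ?snorm_ge0.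
Qed.

Lemma defect_sequence s0 c0 : defect_identity s0 c0 ->
  exists c : nat -> {linear K -> H}, [/\ c 0%N = c0,
    forall n u, c n.+1 (V u) = c n u &
    forall n x, \sum_(k < n) rdot (c k.+1 x) (c k.+1 x) <= s0 x x].
Proof.
move=> h0; pose state := {p | defect_identity p.1 p.2}.
have /choice[next hnext] (p : state) : exists q : state,
    (forall u, (sval q).2 (V u) = (sval p).2 u) /\
    (sval q).1 = defect_sub (sval p).1 (sval q).2.
  case: p => -[s c] /= /defect_step[c' [h h']].
  by exists (exist _ (defect_sub s c', c') h').
pose st n : state := iter n next (exist _ (s0, c0) h0).
exists (fun n => (sval (st n)).2); split=> // [n u|n x].
  by case: (hnext (st n)).
have st_sum : (sval (st n)).1 x x =
    s0 x x - \sum_(k < n) rdot ((sval (st k.+1)).2 x) ((sval (st k.+1)).2 x).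
  elim: n => [|n IH]; first by rewrite big_ord0 subr0.
  rewrite big_ord_recr/= -/(st n).
  case: (hnext (st n)) => _ ->; rewrite /defect_sub IH; ring.
by have := si_ge0 (proj1 (svalP (st n))) x; rewrite st_sum subr_ge0.
Qed.

End DefectSequence.

(** * Lifting through a contractive lift on the target *)

Section Lifting.
Context {R : realType}.
Local Open Scope complex_scope.
Context {H K1 K2 : hilbertType R}.
Variables (V : {linear K1 -> K1}) (W : {linear K2 -> K2}) (S : {linear H -> H}).
Variables (j : {linear H -> K2}) (X : {linear K1 -> H}) (r : R).
Hypothesis V_iso : forall x, hn (V x) = hn x.
Hypothesis W_le : forall x, hn (W x) <= hn x.
Hypothesis j_iso : forall h h', rdot (j h) (j h') = rdot h h'.
Hypothesis W_compress : forall h h', rdot (W (j h)) (j h') = rdot (S h) h'.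
Hypothesis W_perp : forall w, (forall h, rdot w (j h) = 0) ->
  forall h, rdot (W w) (j h) = 0.
Hypothesis XV : forall x, X (V x) = S (X x).
Hypothesis X_le : forall x, hn (X x) <= r * hn x.

Local Notation rs := rdot_semi_inner.

Lemma rdot_hn {F : hilbertType R} (x : F) : rdot x x = hn x ^+ 2.
Proof. by rewrite (sqr_snorm rs). Qed.

Lemma j_hn h : hn (j h) = hn h. Proof. by rewrite /snorm j_iso. Qed.

Lemma S_le h : hn (S h) <= hn h.
Proof.
apply: (snorm_le_of_sqr rs (snorm_ge0 _)); rewrite -W_compress.
apply: le_trans (cauchy_schwarz_le rs _ _) _.
by rewrite j_hn ler_wpM2r ?snorm_ge0// -(j_hn h) W_le.
Qed.

(** The part of [W] that leads from [H] to its orthogonal complement. *)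
Definition exit_map : {linear H -> K2} := (W \o j) \- (j \o S).

Lemma exit_mapE h : exit_map h = W (j h) - j (S h). Proof. by []. Qed.

Lemma exit_perp h h' : rdot (exit_map h) (j h') = 0.
Proof. by rewrite exit_mapE (siDl rs) (siNl rs) W_compress j_iso subrr. Qed.

(** Contractivity of [W] at [j h + w], whose image splits orthogonally into
    [j (S h)] and [exit_map h + W w]. *)
Lemma exit_row h w : (forall h, rdot w (j h) = 0) ->
  rdot (exit_map h + W w) (exit_map h + W w) <=
    (rdot h h - rdot (S h) (S h)) + rdot w w.
Proof.
move=> wj; set z := exit_map h + W w.
have zj h' : rdot z (j h') = 0.
  by rewrite (siDl rs) exit_perp W_perp// addr0.
have WE : W (j h + w) = j (S h) + z.
  by rewrite linearD /z exit_mapE [RHS]addrA subrKC.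
have := W_le (j h + w); rewrite -ler_sqr ?nnegrE ?snorm_ge0//.
rewrite -!rdot_hn WE !(si_sqrD rs) !j_iso (siC rs _ z) zj (siC rs _ w) wj.
lra.
Qed.

(** By [exit_row] with [w = 0], [exit_map] is dominated by the defect [D] and
    hence factors through it; the values of [G] are limits of values of [exit_map]
    with control of the norms [hn (D u)], so that [exit_row] passes to the row
    [(G, W)]. *)
Lemma gamma_ex (D : {linear H -> H}) :
  (forall h, rdot (D h) (D h) = rdot h h - rdot (S h) (S h)) ->
  exists G : {linear H -> K2}, [/\ forall h, G (D h) = exit_map h,
    forall e h, rdot (G e) (j h) = 0 &
    forall e w, (forall h, rdot w (j h) = 0) ->
      rdot (G e + W w) (G e + W w) <= rdot e e + rdot w w].
Proof.
move=> hD.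
have exit_le h : hn (exit_map h) <= hn (D h).
  rewrite /snorm ler_wsqrtr// hD.
  have := @exit_row h 0 (fun h' => si0l rs _).
  by rewrite linear0 addr0 (si0l rs) addr0.
have [G [GD G_approx]] := contractive_extension rs exit_le.
exists G; split=> // [e h|e w wj].
  apply/eqP; rewrite -normr_le0; apply/ler_addgt0Pr => d d0; rewrite add0r.
  have h0 := snorm_ge0 (s := rdot) h.
  have [d' d1 de] := small_factor h0 d0.
  have [u [h1 _]] := G_approx e _ d1.
  rewrite -[G e](subrK (exit_map u)) (siDl rs) exit_perp addr0.
  apply: le_trans (cauchy_schwarz rs _ _) _; rewrite j_hn; nra.
(* [t] is the norm of the pair [(e, w)] *)
pose t := Num.sqrt (rdot e e + rdot w w).
have t2 : t ^+ 2 = hn e ^+ 2 + hn w ^+ 2.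
  by rewrite sqr_sqrtr -?rdot_hn// addr_ge0 ?(si_ge0 rs).
have t0 : 0 <= t := sqrtr_ge0 _.
have et : hn e <= t.
  by rewrite -ler_sqr ?nnegrE ?snorm_ge0// t2 lerDl sqr_ge0.
have -> : rdot e e + rdot w w = t ^+ 2 by rewrite t2 !rdot_hn.
rewrite rdot_hn ler_sqr ?nnegrE ?snorm_ge0//.
apply/ler_addgt0Pr => d d0.
have [u [h1 h2]] := G_approx e _ (half_gt0 d0).
have h3 : hn (exit_map u + W w) <= t + d / 2.
  rewrite -ler_sqr ?nnegrE ?snorm_ge0//; last by lra.
  have := exit_row u wj; rewrite -hD !rdot_hn => h4.
  have e0 := snorm_ge0 (s := rdot) e; have D0 := snorm_ge0 (s := rdot) (D u).
  have : hn (D u) ^+ 2 <= (hn e + d / 2) ^+ 2 by rewrite ler_sqr ?nnegrE//; lra.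
  by nra.
have -> : G e + W w = (G e - exit_map u) + (exit_map u + W w).
  by rewrite addrA subrK.
by apply: le_trans (snormD rs _ _) _; lra.
Qed.

Section Series.
Variable G : {linear H -> K2}.
Hypothesis G_perp : forall e h, rdot (G e) (j h) = 0.
Hypothesis G_row : forall e w, (forall h, rdot w (j h) = 0) ->
  rdot (G e + W w) (G e + W w) <= rdot e e + rdot w w.

(** The sum of the [W ^ k (G (c k x))] over [k < n], in the nested form to which
    [G_row] applies term by term. *)
Fixpoint horner_sum (n : nat) (c : nat -> {linear K1 -> H}) : {linear K1 -> K2} :=
  if n is m.+1 then (G \o c 0%N) \+ (W \o horner_sum m (fun k => c k.+1)) else \0.

Lemma horner_sumS n c x :
  horner_sum n.+1 c x = G (c 0%N x) + W (horner_sum n (fun k => c k.+1) x).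
Proof. by []. Qed.

Lemma horner_sum_perp n c x h : rdot (horner_sum n c x) (j h) = 0.
Proof.
elim: n c h => [|n IH] c h; first by rewrite (si0l rs).
by rewrite horner_sumS (siDl rs) G_perp add0r W_perp.
Qed.

Lemma horner_sum_le n c x : rdot (horner_sum n c x) (horner_sum n c x) <=
  \sum_(k < n) rdot (c k x) (c k x).
Proof.
elim: n c => [|n IH] c; first by rewrite big_ord0 (si0l rs).
rewrite big_ord_recl horner_sumS.
by apply: le_trans (G_row _ (horner_sum_perp _ _ _)) _; rewrite lerD2l IH.
Qed.

Lemma eq_horner_sum n (c d : nat -> {linear K1 -> H}) x y : (forall k, c k x = d k y) ->
  horner_sum n c x = horner_sum n d y.
Proof.
elim: n c d => [|n IH] c d cd //; rewrite !horner_sumS cd.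
by rewrite (IH _ (fun k => d k.+1)).
Qed.

Lemma horner_sum_tail n m c x :
  hn (horner_sum (n + m) c x - horner_sum n c x) <=
  hn (horner_sum m (fun k => c (n + k)%N) x).
Proof.
elim: n c => [|n IH] c; first by rewrite subr0.
rewrite addSn !horner_sumS opprD addrACA subrr add0r -linearB.
exact: le_trans (W_le _) (IH _).
Qed.

Lemma horner_sum_cvg (c : nat -> {linear K1 -> H}) (M : K1 -> R) :
  (forall n x, \sum_(k < n) rdot (c k x) (c k x) <= M x) ->
  exists Z : {linear K1 -> K2},
    (forall x, tends_to (fun n => horner_sum n c x) (Z x)).
Proof.
move=> hM; apply: linear_limit => x; apply: hilbert_complete => e e0.
pose b n := \sum_(k < n) rdot (c k x) (c k x).
have bE n m : b (n + m)%N - b n = \sum_(k < m) rdot (c (n + k)%N x) (c (n + k)%N x).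
  by rewrite /b big_split_ord/= addrAC subrr add0r.
have b_homo : {homo b : m n / (m <= n)%N >-> m <= n}.
  move=> m n /subnKC <-; rewrite -subr_ge0 bE.
  by apply: sumr_ge0 => k _; apply: (si_ge0 rs).
have e2_ge0 : 0 <= e / 2 by rewrite ltW// half_gt0.
have d0 : 0 < (e / 2) ^+ 2 by rewrite exprn_gt0// half_gt0.
have [N hN] := monotone_cauchy b_homo (fun n => hM n x) d0.
have tail n : (N <= n)%N -> hn (horner_sum n c x - horner_sum N c x) <= e / 2.
  move=> Nn; have := hN n Nn; rewrite -(subnKC Nn) bE => h.
  apply: le_trans (horner_sum_tail _ _ _ _) _.
  rewrite -ler_sqr ?nnegrE ?snorm_ge0 ?e2_ge0// -rdot_hn.
  apply: le_trans h; exact: (horner_sum_le _ (fun k => c (N + k)%N)).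
exists N => m n Nm Nn.
have -> : horner_sum m c x - horner_sum n c x =
  (horner_sum m c x - horner_sum N c x) - (horner_sum n c x - horner_sum N c x).
  by rewrite opprB addrA subrK.
apply: le_trans (snormB rs _ _) _.
by have := tail m Nm; have := tail n Nn; lra.
Qed.

End Series.

(** [Y = j X + \sum_k W ^ k G c(k+1)].  Composing with [V] turns [j X] into
    [j S X], the first summand into [G D X = (W j - j S) X], and every later one
    into [W] applied to its predecessor. *)
Theorem intertwining_lift : exists Y : {linear K1 -> K2},
  [/\ forall x h, rdot (Y x) (j h) = rdot (X x) h,
      forall x, hn (Y x) <= r * hn x &
      forall x, Y (V x) = W (Y x)].
Proof.
have [D hD] := defect_operator S_le.
have [G [GD G_perp G_row]] := gamma_ex hD.
(* [r ^ 2 |x| ^ 2 - |X x| ^ 2] is what the norm bound leaves for the series *)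
pose s0 x y : R := r ^+ 2 * rdot x y - rdot (X x) (X y).
have s0_ge0 x : 0 <= s0 x x.
  rewrite /s0 subr_ge0 !rdot_hn -exprMn ler_sqr ?nnegrE ?snorm_ge0//.
  by apply: le_trans (X_le x); apply: snorm_ge0.
have h0 : defect_identity V s0 (D \o X).
  split; last first.
    by move=> u; rewrite /s0 /= hD XV (rdot_hn (V u)) V_iso (rdot_hn u); ring.
  split=> //; rewrite /s0.
  - by move=> x y; rewrite (siC rs) (siC rs (X x)).
  - by move=> x y z; rewrite linearD !(siDl rs); ring.
  - by move=> a x y; rewrite linearZ !(siZl rs); ring.
  - by move=> a x y; rewrite !linearZ !(siJ rs).
(* the component [c 0 = D X] only starts the recursion: the series uses
   [c k.+1] *)
have [c [c0 cV c_le]] := defect_sequence h0.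
have [Z hZ] := horner_sum_cvg (c := fun k => c k.+1) G_perp G_row c_le.
have Z_perp x h : rdot (Z x) (j h) = 0.
  by apply: (tends_to_rdot_cst (hZ x)) => n; apply: horner_sum_perp.
exists ((j \o X) \+ Z); split=> [x h|x|x] /=.
- by rewrite (siDl rs) j_iso Z_perp addr0.
- have Z_le : hn (Z x) <= Num.sqrt (s0 x x).
    apply: (tends_to_hn_le (hZ x)) => n; rewrite /snorm ler_wsqrtr//.
    apply: le_trans (c_le n x).
    exact: (horner_sum_le G_perp G_row n (fun k => c k.+1)).
  have rx0 : 0 <= r * hn x := le_trans (snorm_ge0 _) (X_le x).
  rewrite -ler_sqr ?nnegrE ?snorm_ge0// -rdot_hn.
  rewrite (si_sqrD rs) (siC rs _ (Z x)) Z_perp j_iso.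
  have : rdot (Z x) (Z x) <= s0 x x.
    by rewrite rdot_hn -(sqr_sqrtr (s0_ge0 x)) ler_sqr ?nnegrE ?snorm_ge0 ?sqrtr_ge0.
  by rewrite /s0 exprMn -(rdot_hn x); lra.
- have -> : Z (V x) = exit_map (X x) + W (Z x).
    apply: (@tends_to_uniq _ _ (fun n => horner_sum G n.+1 (fun k => c k.+1) (V x))).
      apply: (tends_to_shift (fun n => horner_sum G n (fun k => c k.+1) (V x)) _).2 (hZ (V x)).
    have -> : (fun n => horner_sum G n.+1 (fun k => c k.+1) (V x)) =
        fun n => exit_map (X x) + W (horner_sum G n (fun k => c k.+1) x).
      apply/funext => n; rewrite horner_sumS cV c0/= GD; congr (_ + W _).
      by apply: eq_horner_sum => k; rewrite cV.
    apply: tends_toD; first exact: tends_to_const.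
    exact: tends_to_map W_le (hZ x).
  by rewrite XV exit_mapE linearD addrA addrCA subrr addr0.
Qed.

End Lifting.

(** * Bounded operators, operator norms and adjoints *)

Section BoundedOperators.
Context {R : realType}.
Local Open Scope complex_scope.
Implicit Types (H K F : hilbertType R).
Local Notation rs := rdot_semi_inner.

Lemma bounded_hn {H K} (f : {bounded H -> K}) :
  exists2 M : R, 0 <= M & forall x, hn (f x) <= M * hn x.
Proof.
have [M hM] := @bounded_operator _ _ _ f.
exists `|complex.Re M| => // x; have := hM x; rewrite !normE.
case: M {hM} => a b; rewrite lecE/= => /andP[_].
rewrite mulr0 subr0 => h; apply: le_trans h _.
by rewrite ler_wpM2r ?snorm_ge0// ler_norm.
Qed.

Lemma unit_ball_ub {H K} (f : {bounded H -> K}) (M : R) : 0 <= M ->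
  (forall x, hn (f x) <= M * hn x) ->
  ubound [set complex.Re `|f x| | x in [set x | `|x| <= 1]]%classic M.
Proof.
move=> M0 hM _ [x /= x1 <-]; rewrite normE/=; apply: le_trans (hM x) _.
rewrite -[leRHS]mulr1 ler_wpM2l//.
by move: x1; rewrite normE -[1 in X in X -> _]/(1%:C) lecR.
Qed.

Lemma opnorm_le {H K} (f : {bounded H -> K}) (M : R) : 0 <= M ->
  (forall x, hn (f x) <= M * hn x) -> opnorm f <= M.
Proof.
move=> M0 hM; apply: ge_sup; last exact: unit_ball_ub.
by exists (complex.Re `|f 0|), 0 => //=; rewrite normr0 ler01.
Qed.

Lemma hn_le_opnorm {H K} (f : {bounded H -> K}) x : hn (f x) <= opnorm f * hn x.
Proof.
have [M M0 hM] := bounded_hn f.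
have [x0|x0] := eqVneq (hn x) 0.
  by have := hM x; rewrite x0 !mulr0.
have xp : 0 < hn x by rewrite lt0r x0 snorm_ge0.
have yE : hn ((hn x)^-1%:C *: x) = 1.
  rewrite (snormZ rs) ger0_norm ?lecR ?invr_ge0 ?snorm_ge0//=.
  by rewrite mulVf.
rewrite -ler_pdivrMr// mulrC.
have -> : (hn x)^-1 * hn (f x) = complex.Re `|f ((hn x)^-1%:C *: x)|.
  rewrite normE/= linearZ (snormZ rs) ger0_norm ?lecR ?invr_ge0 ?snorm_ge0//=.
apply: ub_le_sup; last by exists ((hn x)^-1%:C *: x) => //=; rewrite normE yE.
by exists M; apply: unit_ball_ub.
Qed.

Lemma opnorm_ge0 {H K} (f : {bounded H -> K}) : 0 <= opnorm f.
Proof.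
have [M M0 hM] := bounded_hn f.
apply: ub_le_sup; last by exists 0 => //=; rewrite ?linear0 ?normr0 ?ler01.
by exists M; apply: unit_ball_ub.
Qed.

Lemma contraction_hn {H K} (f : {bounded H -> K}) :
  contraction_op f -> forall x, hn (f x) <= hn x.
Proof.
move=> hf x; apply: le_trans (hn_le_opnorm f x) _.
by rewrite -[leRHS]mul1r ler_wpM2r// snorm_ge0.
Qed.

Lemma rdot_adjoint {H K} (f : {bounded H -> K}) x y :
  rdot (f x) y = rdot x (adjoint f y).
Proof.
have [M _ hM] := bounded_hn f.
have [g hg] := adjoint_ex hM.
have : [set z | forall x, hdot (f x) y = hdot x z]%classic (adjoint f y).
  by apply: (xgetPex 0); exists (g y); apply: hdot_rdot => z; apply: hg.
by move=> /(_ x); rewrite /rdot => ->.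
Qed.

Lemma adjoint_uniq {H K} (f : {bounded H -> K}) y z :
  (forall x, rdot (f x) y = rdot x z) -> adjoint f y = z.
Proof. by move=> h; apply: rdot_inj => x; rewrite -rdot_adjoint h. Qed.

Lemma bounded_of_linear {H K} (f : {linear H -> K}) (M : R) :
  (forall x, hn (f x) <= M * hn x) ->
  exists g : {bounded H -> K}, forall x, g x = f x.
Proof.
move=> hf; have b : exists M : R[i], forall x, `|f x| <= M * `|x|.
  by exists M%:C => x; rewrite !normE -rmorphM lecR.
pose m := isBoundedOperator.Build R[i] H K f b.
by exists (HB.pack (GRing.Linear.sort f) f m : {bounded H -> K}).
Qed.

Lemma inclusion_rdot {H K} (j : {linear H -> K}) : hilbert_inclusion j ->
  forall h h', rdot (j h) (j h') = rdot h h'.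
Proof. by move=> hj h h'; rewrite /rdot hj. Qed.

End BoundedOperators.

(** * The lifting theorem *)

Theorem theorem6p1 (R : realType) (H K1 K2 : hilbertType R)
    (j1 : {linear H -> K1}) (j2 : {linear H -> K2})
    (hj1 : hilbert_inclusion j1) (hj2 : hilbert_inclusion j2)
    (Q T1 T2 X : {bounded H -> H})
    (hT1 : contraction_op T1) (hT2 : contraction_op T2)
    (hQT2 : contraction_op (Q \o T2))
    (hX : X \o T1 = Q \o T2 \o X)
    (V1 : {bounded K1 -> K1}) (hV1 : lift_of j1 j1 T1 V1) (iV1 : isometric_op V1)
    (V2 : {bounded K2 -> K2}) (hV2 : lift_of j2 j2 T2 V2) (iV2 : isometric_op V2)
    (Qbar : {bounded K2 -> K2}) (hQbar : lift_of j2 j2 Q Qbar)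
    (hQV2 : contraction_op (Qbar \o V2)) :
  exists Y : {bounded K1 -> K2},
    [/\ lift_of j1 j2 X Y, opnorm Y = opnorm X & Y \o V1 = Qbar \o V2 \o Y].
Proof.
have j1E := inclusion_rdot hj1; have j2E := inclusion_rdot hj2.
have j1_le x : snorm rdot (j1 x) <= 1 * snorm rdot x by rewrite mul1r /snorm j1E.
(* [P] is the adjoint of [j1], the orthogonal projection of [K1] onto [H] *)
have [P hP] := adjoint_ex j1_le.
have P_le : forall y, snorm rdot (P y) <= snorm rdot y.
  by apply: contraction_adjoint hP => x; rewrite -[leRHS]mul1r.
have rC (F : hilbertType R) := siC (@rdot_semi_inner R F).
have PV x : P (V1 x) = T1 (P x).
  apply: rdot_inj => h; rewrite -hP rC rdot_adjoint hV1 rC hP.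
  by rewrite [RHS]rC rdot_adjoint rC.
have WE w h : rdot (Qbar (V2 w)) (j2 h) = rdot w (j2 (adjoint T2 (adjoint Q h))).
  by rewrite rdot_adjoint hQbar rdot_adjoint hV2.
have XP_le x : snorm rdot (X (P x)) <= opnorm X * snorm rdot x.
  apply: le_trans (hn_le_opnorm X _) _.
  by rewrite ler_wpM2l// opnorm_ge0.
have [||h h'|w hw h|x|Y0 [Y0_lift Y0_le Y0V]] := @intertwining_lift R H K1 K2 V1
    (Qbar \o V2) (Q \o T2) j2 (X \o P) (opnorm X) _ _ j2E _ _ _ XP_le.
- by move=> x; rewrite /snorm /rdot !hdotxx iV1.
- exact: contraction_hn hQV2.
- by rewrite /= WE j2E -!rdot_adjoint.
- by rewrite /= WE hw.
- by rewrite /= PV; have /= := congr1 (@^~ (P x)) hX.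
have [Y YE] := bounded_of_linear Y0_le.
have Y_lift x h : rdot (Y x) (j2 h) = rdot (X (P x)) h by rewrite YE Y0_lift.
exists Y; split.
- move=> h; apply: adjoint_uniq => x.
  by rewrite Y_lift rdot_adjoint [RHS]rC hP rC.
- apply/le_anti/andP; split; apply: opnorm_le (opnorm_ge0 _) _ => x.
    by rewrite YE.
  (* [X] is the compression of [Y] to [H], because [P] inverts [j1] *)
  have Pj : P (j1 x) = x by apply: rdot_inj => h; rewrite -hP j1E.
  apply: (snorm_le_of_sqr rdot_semi_inner).
    by rewrite mulr_ge0 ?opnorm_ge0 ?snorm_ge0.
  rewrite -{1}Pj -Y_lift; apply: le_trans (cauchy_schwarz_le rdot_semi_inner _ _) _.
  have -> : snorm rdot (j2 (X x)) = snorm rdot (X x) by rewrite /snorm j2E.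
  have -> : snorm rdot x = snorm rdot (j1 x) by rewrite /snorm j1E.
  by rewrite ler_wpM2r ?snorm_ge0// hn_le_opnorm.
- by apply/funext => x; rewrite /= !YE Y0V.
Qed.
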